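(* Let $V$ be an ($\mathbb{R}$-indexed) pointwise finite dimensional (PFD) persistence module and $V^{\mathbb{Z}}$ the associated $\mathbb{Z}$-discretized PFD persistence module. Then: (i) $(V^{\mathbb{Z}},V)$ are $(\tau,\sigma)$-interleaved, where $\tau(t)=t$ and $\sigma(t)=\lceil t\rceil$; and (ii) there exists a matching $\mathcal{X}\colon\mathsf{PD}(V^{\mathbb{Z}})\nrightarrow\mathsf{PD}(V)$ such that if $\mathcal{X}([b,d,i])=[b',d',i']$, then $$b-1\le b'\le b\quad\text{and}\quad d-1\le d'\le d.$$ Additionally, any unmatched point $[b,d,i]\in\mathsf{PD}(V^{\mathbb{Z}})$ satisfies $d=b+1$, and any unmatched point $[b',d',i']\in\mathsf{PD}(V)$ satisfies $d'\le\lfloor b'+1\rfloor$.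
   Context: Fix a field $\mathsf{k}$; $\overline{\mathbb{R}}=\mathbb{R}\cup\{\pm\infty\}$, with the usual conventions for adding reals to, and taking floors of, $\pm\infty$. A persistence module $V=(V,\varphi_V)$ is a family of $\mathsf{k}$-vector spaces $\{V_t\}_{t\in\mathbb{R}}$ with linear maps $\varphi_V(s,t)\colon V_s\to V_t$ for $s\le t$ such that $\varphi_V(t,t)=\mathrm{id}$ and $\varphi_V(s,t)\circ\varphi_V(r,s)=\varphi_V(r,t)$ for $r\le s\le t$. It is PFD if every $V_t$ is finite-dimensional. A morphism $\phi\colon V\to W$ is a family of linear maps $\phi_t\colon V_t\to W_t$ with $\phi_t\circ\varphi_V(s,t)=\varphi_W(s,t)\circ\phi_s$ for $s\le t$. The $\mathbb{Z}$-discretized persistence module $V^{\mathbb{Z}}$ is $V^{\mathbb{Z}}_t=V_{\lfloor t\rfloor}$, $\varphi_{V^{\mathbb{Z}}}(s,t)=\varphi_V(\lfloor s\rfloor,\lfloor t\rfloor)$. Interleavings: a translation map is a monotone (non-decreasing) $\sigma\colon\mathbb{R}\to\mathbb{R}$ with $x\le\sigma(x)$ for all $x$. A translation pair is a pair $(\tau,\sigma)$ of monotone functions $\mathbb{R}\to\mathbb{R}$ such that $\tau\circ\sigma$ and $\sigma\circ\tau$ are translation maps. For $\sigma$ monotone, $V(\sigma)_t=V_{\sigma(t)}$ with $\varphi_{V(\sigma)}(s,t)=\varphi_V(\sigma(s),\sigma(t))$; for a morphism $\phi$, $\phi(\sigma)_t=\phi_{\sigma(t)}$. For a translation pair $(\tau,\sigma)$,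 an ordered pair $(V,W)$ is $(\tau,\sigma)$-interleaved if there are morphisms $\phi\colon V\to W(\tau)$, $\psi\colon W\to V(\sigma)$ with $\psi(\tau)_t\circ\phi_t=\varphi_V(t,(\sigma\circ\tau)(t))$ and $\phi(\sigma)_t\circ\psi_t=\varphi_W(t,(\tau\circ\sigma)(t))$ for all $t\in\mathbb{R}$. Undecorated persistence diagram: every PFD persistence module $V$ is a direct sum of interval modules $I_J$ ($J\subseteq\mathbb{R}$ a nonempty interval; $\mathsf{k}$ on $J$, $0$ elsewhere, identity maps within $J$), uniquely up to reindexing. $\mathsf{PD}(V)\subset\overline{\mathbb{R}}^2\times\mathbb{N}_{>0}$ is a set of points $[b,d,i]$ in bijection with the interval summands of $V$ (counted with multiplicity), where a summand $I_J$ corresponds to a point with $b=\inf J$, $d=\sup J$ (the index $i$ distinguishes points with equal $(b,d)$). A matching $\mathcal{X}\colon S\nrightarrow T$ is a relation that is the graph of an injective function $S'\to T'$, $S'\subseteq S$, $T'\subseteq T$; $\mathcal{X}(s)=t$ means $(s,t)\in\mathcal{X}$; points outside the domain/image of this function are unmatched. *)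

(* Defs.v *)
From HB Require Import structures.
From mathcomp Require Import all_boot all_order all_algebra.
From mathcomp Require Import all_classical all_reals ereal normedtype.

Set Implicit Arguments.
Unset Strict Implicit.
Unset Printing Implicit Defensive.

Import Order.TTheory GRing.Theory Num.Theory.

Local Open Scope classical_set_scope.
Local Open Scope ring_scope.

Section PersistenceModules.
Variables (k : fieldType) (R : realType).

Record pmodule := PModule {
  pm_space :> R -> lmodType k;
  pm_map : forall s t, s <= t -> {linear pm_space s -> pm_space t};
  pm_map_id : forall t (tt : t <= t) (x : pm_space t), pm_map tt x = x;
  pm_map_comp : forall r s t (rs : r <= s) (st : s <= t) (rt : r <= t)
    (x : pm_space r), pm_map st (pm_map rs x) = pm_map rt x }.

Definition pfd (V : pmodule) : Prop :=
  forall t, exists n, inhabited (Vector.axiom n (V t)).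

Record pm_hom (V W : pmodule) := PMHom {
  pm_hom_at :> forall t, {linear V t -> W t};
  pm_hom_natural : forall s t (st : s <= t) (x : V s),
    pm_hom_at t (pm_map V st x) = pm_map W st (pm_hom_at s x) }.

Definition pm_iso (V W : pmodule) : Prop :=
  exists (f : pm_hom V W) (g : pm_hom W V),
    forall t, cancel (f t) (g t) /\ cancel (g t) (f t).

Definition monotone (sigma : R -> R) : Prop := {homo sigma : x y / x <= y}.

(* The reparametrized module V(sigma). *)
Program Definition pm_reindex (V : pmodule) (sigma : R -> R)
    (mon : monotone sigma) : pmodule :=
  @PModule (fun t => V (sigma t)) (fun s t st => pm_map V (mon s t st)) _ _.
Next Obligation. by move=> V sigma mon t tt x; exact: pm_map_id. Qed.
Next Obligation. by move=> V sigma mon r s t rs st rt x; exact: pm_map_comp. Qed.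

Definition floorR (t : R) : R := (Num.floor t)%:~R.
Definition ceilR (t : R) : R := (Num.ceil t)%:~R.

Lemma floorR_monotone : monotone floorR.
Proof. by move=> x y xy; rewrite /floorR ler_int; exact: le_floor. Qed.

Definition discretize (V : pmodule) : pmodule := pm_reindex V floorR_monotone.

Lemma discretize_pfd (V : pmodule) : pfd V -> pfd (discretize V).
Proof. by move=> Vfd t; exact: (Vfd (floorR t)). Qed.

Definition translation_map (sigma : R -> R) : Prop :=
  monotone sigma /\ forall x, x <= sigma x.

Record translation_pair (tau sigma : R -> R) : Prop := TranslationPair {
  tp_left : monotone tau;
  tp_right : monotone sigma;
  tp_left_right : translation_map (tau \o sigma);
  tp_right_left : translation_map (sigma \o tau) }.

Definition interleaved (tau sigma : R -> R) (V W : pmodule) : Prop :=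
  exists (tp : translation_pair tau sigma)
         (phi : pm_hom V (pm_reindex W (tp_left tp)))
         (psi : pm_hom W (pm_reindex V (tp_right tp))),
    (forall t (x : V t),
       psi (tau t) (phi t x) = pm_map V (proj2 (tp_right_left tp) t) x) /\
    (forall t (x : W t),
       phi (sigma t) (psi t x) = pm_map W (proj2 (tp_left_right tp) t) x).

End PersistenceModules.

(* External direct sums, as finitely supported families. *)
Section DirectSum.
Variables (k : fieldType) (I : Type) (U : I -> lmodType k).

Record dsum := DSum {
  dsum_val :> forall i, U i;
  dsum_finite : finite_set [set i | dsum_val i <> 0] }.

Lemma dsumP (f g : dsum) : (forall i, f i = g i) -> f = g.
Proof.
case: f => f hf; case: g => g hg /= fg.
have {}fg : f = g by exact: functional_extensionality_dep.
by subst g; congr DSum; exact: Prop_irrelevance.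
Qed.

HB.instance Definition _ := gen_eqMixin dsum.
HB.instance Definition _ := gen_choiceMixin dsum.

Program Definition dsum_zero : dsum := @DSum (fun=> 0) _.
Next Obligation.
by apply: (sub_finite_set _ (@finite_set0 I)) => i /=; exact.
Qed.

Program Definition dsum_opp (f : dsum) : dsum := @DSum (fun i => - f i) _.
Next Obligation.
move=> f; apply: (sub_finite_set _ (dsum_finite f)) => i /= + fi0.
by rewrite fi0 oppr0.
Qed.

Program Definition dsum_add (f g : dsum) : dsum :=
  @DSum (fun i => f i + g i) _.
Next Obligation.
move=> f g; have fin : finite_set ([set i | f i <> 0] `|` [set i | g i <> 0]).
  by rewrite finite_setU; split; exact: dsum_finite.
apply: (sub_finite_set _ fin) => i /= fg.
by case: (pselect (f i = 0)) => [fi0|]; [right=> gi0|left];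
  first by apply: fg; rewrite fi0 gi0 addr0.
Qed.

Program Definition dsum_scale (a : k) (f : dsum) : dsum :=
  @DSum (fun i => a *: f i) _.
Next Obligation.
move=> a f; apply: (sub_finite_set _ (dsum_finite f)) => i /= + fi0.
by rewrite fi0 scaler0.
Qed.

Fact dsum_addA : associative dsum_add.
Proof. by move=> f g h; apply: dsumP => i /=; rewrite addrA. Qed.
Fact dsum_addC : commutative dsum_add.
Proof. by move=> f g; apply: dsumP => i /=; rewrite addrC. Qed.
Fact dsum_add0 : left_id dsum_zero dsum_add.
Proof. by move=> f; apply: dsumP => i /=; rewrite add0r. Qed.
Fact dsum_addN : left_inverse dsum_zero dsum_opp dsum_add.
Proof. by move=> f; apply: dsumP => i /=; rewrite addNr. Qed.

HB.instance Definition _ :=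
  GRing.isZmodule.Build dsum dsum_addA dsum_addC dsum_add0 dsum_addN.

Fact dsum_scaleA (a b : k) (f : dsum) :
  dsum_scale a (dsum_scale b f) = dsum_scale (a * b) f.
Proof. by apply: dsumP => i /=; rewrite scalerA. Qed.
Fact dsum_scale1 : left_id 1 dsum_scale.
Proof. by move=> f; apply: dsumP => i /=; rewrite scale1r. Qed.
Fact dsum_scaleDr : right_distributive dsum_scale +%R.
Proof. by move=> a f g; apply: dsumP => i /=; rewrite scalerDr. Qed.
Fact dsum_scaleDl (f : dsum) :
  {morph dsum_scale^~ f : a b / a + b >-> a + b}.
Proof. by move=> a b; apply: dsumP => i /=; rewrite scalerDl. Qed.

HB.instance Definition _ :=
  GRing.Zmodule_isLmodule.Build k dsum
    dsum_scaleA dsum_scale1 dsum_scaleDr dsum_scaleDl.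

End DirectSum.

Section DirectSumMap.
Variables (k : fieldType) (I : Type) (U W : I -> lmodType k).
Variable h : forall i, {linear U i -> W i}.

Program Definition dsum_map (f : dsum U) : dsum W :=
  @DSum _ _ _ (fun i => h i (f i)) _.
Next Obligation.
move=> f; apply: (sub_finite_set _ (dsum_finite f)) => i /= + fi0.
by rewrite fi0 linear0.
Qed.

Fact dsum_map_linear : linear dsum_map.
Proof. by move=> a f g; apply: dsumP => i /=; rewrite linearP. Qed.

HB.instance Definition _ :=
  GRing.isLinear.Build k (dsum U) (dsum W) _ dsum_map dsum_map_linear.

End DirectSumMap.

Section Diagrams.
Variables (k : fieldType) (R : realType).

Program Definition pm_dsum (I : Type) (W : I -> pmodule k R) : pmodule k R :=
  @PModule k R (fun t => dsum (fun i => W i t))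
    (fun s t st => dsum_map (fun i => pm_map (W i) st)) _ _.
Next Obligation.
by move=> I W t tt f; apply: dsumP => i /=; exact: pm_map_id.
Qed.
Next Obligation.
by move=> I W r s t rs st rt f; apply: dsumP => i /=; exact: pm_map_comp.
Qed.

Record rinterval := RInterval {
  rint_set :> set R;
  rint_nonempty : rint_set !=set0;
  rint_interval : is_interval rint_set }.

(* The boolean t \in J is used as a dimension: the space at t is 'rV_1 on J
   and 'rV_0 elsewhere; pid_mx 1 is then the identity between points of J,
   and zero otherwise. *)
Definition interval_space (J : rinterval) (t : R) : lmodType k :=
  'rV[k]_(t \in (J : set R)).

Definition interval_map (J : rinterval) (s t : R) (st : s <= t) :
    {linear interval_space J s -> interval_space J t} :=
  mulmxr (pid_mx 1 : 'M[k]_(s \in (J : set R), t \in (J : set R))).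

Fact interval_map_id (J : rinterval) t (tt : t <= t)
  (x : interval_space J t) : interval_map J tt x = x.
Proof.
move: x; rewrite /interval_map /interval_space /=.
case: (t \in (J : set R)) => x /=; last by rewrite [LHS]thinmx0 [RHS]thinmx0.
by rewrite pid_mx_1 mulmx1.
Qed.

Fact interval_map_comp (J : rinterval) r s t (rs : r <= s) (st : s <= t)
    (rt : r <= t) (x : interval_space J r) :
  interval_map J st (interval_map J rs x) = interval_map J rt x.
Proof.
have Js : r \in (J : set R) -> t \in (J : set R) -> s \in (J : set R).
  rewrite !inE => Jr Jt; apply: (rint_interval Jr Jt).
  by rewrite rs st.
move: x Js; rewrite /interval_map /interval_space /=.
case: (r \in (J : set R)); case: (t \in (J : set R)) => x Js /=;
  rewrite ?[LHS]thinmx0 ?[RHS]thinmx0 //; last first.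
  by rewrite [x]thinmx0 !mul0mx.
by rewrite Js // -mulmxA mul_pid_mx.
Qed.

Definition interval_module (J : rinterval) : pmodule k R :=
  @PModule k R (interval_space J) (@interval_map J)
    (@interval_map_id J) (@interval_map_comp J).

(* The point [b, d, i] is encoded as the triple (b, d, i). *)
Definition dpoint : Type := (\bar R * \bar R * nat)%type.
Definition birth (p : dpoint) : \bar R := p.1.1.
Definition death (p : dpoint) : \bar R := p.1.2.
Definition copy (p : dpoint) : nat := p.2.

(* D is a persistence diagram of V. It is determined up to the choice of the
   decomposition and of the indices of its points, hence a predicate. *)
Definition is_PD (V : pmodule k R) (D : set dpoint) : Prop :=
  D `<=` [set p | (0 < copy p)%N] /\
  exists (I : Type) (J : I -> rinterval) (e : I -> dpoint),
    [/\ pm_iso V (pm_dsum (fun i => interval_module (J i))),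
        set_bij [set: I] D e &
        forall i, birth (e i) = ereal_inf (EFin @` J i) /\
                  death (e i) = ereal_sup (EFin @` J i)].

End Diagrams.

Section Matchings.
Variables (A B : Type) (S : set A) (T : set B).

(* S' and T' are coerced to the corresponding subtypes. *)
Definition is_matching (X : set (A * B)) : Prop :=
  exists (S' : set A) (T' : set B) (f : S' -> T'),
    [/\ S' `<=` S, T' `<=` T, injective f &
        X = [set st | exists s : S', st = (set_val s, set_val (f s))]].

Definition unmatched_left (X : set (A * B)) (s : A) : Prop :=
  S s /\ forall t, ~ X (s, t).
Definition unmatched_right (X : set (A * B)) (t : B) : Prop :=
  T t /\ forall s, ~ X (s, t).

End Matchings.

Definition efloor (R : realType) : \bar R -> \bar R := er_map (@floorR R).

(* Main.v *)
From HB Require Import structures.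
Require Import Defs.
From mathcomp Require Import all_boot all_order all_algebra.
From mathcomp Require Import finmap.
From mathcomp Require Import all_classical all_reals ereal normedtype.

Set Implicit Arguments.
Unset Strict Implicit.
Unset Printing Implicit Defensive.

Import Order.TTheory GRing.Theory Num.Theory.

Local Open Scope classical_set_scope.
Local Open Scope ring_scope.

(** Discretizing an interval module I_J yields the interval module of
    JZ = {t | floor t is in J}, or zero when J contains no integer.  If J
    contains an integer, then JZ is the union of the [n, n + 1[ for n an integer
    of J, so that inf J lies in [inf JZ - 1, inf JZ] and sup J in
    [sup JZ - 1, sup JZ].  If it contains none, then J lies between two
    consecutive integers n and n + 1, so that sup J <= n + 1 <=
    floor (inf J + 1).

    Hence a decomposition of V into intervals induces one of the discretized
    module, and everything rests on comparing the latter with the decomposition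
    that defines the given diagram: this is the uniqueness of multiplicities,
    [ib_multiplicity_eq].  The required part of the Krull-Remak-Schmidt-Azumaya
    theorem has a short proof here.  Let e_i, c_i be the basis vectors and
    coordinates at t of a first decomposition and e'_j, c'_j those of a second.
    If J i = J i' = K and t is in K, then
      delta_{i i'} = c_{i'}(e_i) = \sum_j c'_j(e_i) c_{i'}(e'_j),
    and the terms with J' j <> K vanish, because the composite of morphisms
    I_K -> I_K' -> I_K is zero for distinct intervals K and K'
    ([ib_round_trip0]).  The matrix (c'_j(e_i)), with i and j restricted to the
    summands equal to K, therefore has a right inverse, so there are at most as
    many indices i as indices j; exchanging the roles gives equality.
    Pointwise finite dimensionality makes these index sets finite.

    The matching pairs each summand JZ of the discretized module with a summand
    J of V whose discretization is JZ.  It leaves no point on the left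
    unmatched, and on the right only the intervals without integers.

    For the interleaving, both morphisms are made of structure maps of V, along
    floor t <= t and t <= floor (ceil t). *)

(** * Rounding *)

Section Rounding.
Variable R : realType.
Implicit Types (x y : R) (n : int).

Lemma floorR_le x : floorR x <= x.
Proof. by rewrite /floorR -floor_ge_int. Qed.

Lemma le_floorR n x : n%:~R <= x -> n%:~R <= floorR x.
Proof. by rewrite /floorR ler_int floor_ge_int. Qed.

Lemma ltD1_floorR x : x < floorR x + 1.
Proof. by rewrite /floorR -intrD1 floorD1_gt. Qed.

Lemma le_ceilR x : x <= ceilR x.
Proof. by rewrite /ceilR -ceil_le_int. Qed.

Lemma floorR_int n : floorR (n%:~R : R) = n%:~R.
Proof. by rewrite /floorR intrKfloor. Qed.

Lemma ceilR_monotone : monotone (@ceilR R).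
Proof. by move=> x y xy; rewrite /ceilR ler_int; exact: le_ceil. Qed.

End Rounding.

(** * The interleaving of a module and its discretization *)

Section Interleaving.
Variables (k : fieldType) (R : realType) (V : pmodule k R).

Lemma ceilR_translation_pair : translation_pair (fun t : R => t) (@ceilR R).
Proof.
have mid : monotone (fun t : R => t) by [].
split=> //; first exact: ceilR_monotone.
- by split=> [|x]; [exact: ceilR_monotone|exact: le_ceilR].
- by split=> [|x]; [exact: ceilR_monotone|exact: le_ceilR].
Qed.

Lemma le_floorR_ceilR (t : R) : t <= floorR (ceilR t).
Proof. by rewrite /ceilR floorR_int; exact: le_ceilR. Qed.

Lemma discretize_interleaved :
  interleaved (fun t : R => t) (@ceilR R) (discretize V) V.
Proof.
exists ceilR_translation_pair.
have @phi : pm_hom (discretize V)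
    (pm_reindex V (tp_left ceilR_translation_pair)).
  refine (@PMHom k R (discretize V) (pm_reindex V _)
    (fun t => pm_map V (floorR_le t)) _) => s t st x /=.
  by rewrite !(pm_map_comp _ _ (le_trans (floorR_le s) st)).
have @psi : pm_hom V
    (pm_reindex (discretize V) (tp_right ceilR_translation_pair)).
  refine (@PMHom k R V (pm_reindex (discretize V) _)
    (fun t => pm_map V (le_floorR_ceilR t)) _) => s t st x /=.
  by rewrite !(pm_map_comp _ _ (le_trans st (le_floorR_ceilR t))).
by exists phi, psi; split=> t x /=; exact: pm_map_comp.
Qed.

End Interleaving.

(** * Interval bases *)

(** A decomposition of W as a direct sum of interval modules indexed by the
    family J, in terms of elements: [ib_vec i t] is the generator at t of the
    i-th summand (zero outside [J i], by [ib_vec_out]), and [ib_coord i t] is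
    the coordinate along it.  Instead of an expansion of every vector, it is
    required that finitely many coordinates be nonzero and that they separate
    vectors.  The sets [J i] may be empty, so that the notion is
    stable under discretization. *)
Record interval_basis (k : fieldType) (R : realType) (W : pmodule k R)
    (I : Type) (J : I -> set R) := IntervalBasis {
  ib_vec : forall (i : I) (t : R), W t;
  ib_coord : forall (i : I) (t : R), {scalar W t};
  ib_finite : forall t (x : W t), finite_set [set i | ib_coord i t x <> 0];
  ib_separate : forall t (x : W t), (forall i, ib_coord i t x = 0) -> x = 0;
  ib_coord_vec : forall i t, J i t -> ib_coord i t (ib_vec i t) = 1;
  ib_coord_neq : forall i j t, i <> j -> ib_coord i t (ib_vec j t) = 0;
  ib_coord_out : forall i t (x : W t), ~ J i t -> ib_coord i t x = 0;
  ib_map_vec : forall i s t (st : s <= t), J i s ->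
    pm_map W st (ib_vec i s) = ib_vec i t }.

Arguments ib_finite {k R W I J} _ {t} x.
Arguments ib_separate {k R W I J} _ {t} x.
Arguments ib_coord_vec {k R W I J} _ {i t}.
Arguments ib_coord_neq {k R W I J} _ {i j} t.
Arguments ib_coord_out {k R W I J} _ {i t} x.
Arguments ib_map_vec {k R W I J} _ {i s t} st.

Section IntervalBasis.
Variables (k : fieldType) (R : realType).

Lemma ib_vec_out (W : pmodule k R) (I : Type) (J : I -> set R)
    (B : interval_basis W J) i t : ~ J i t -> ib_vec B i t = 0.
Proof.
move=> Jit; apply: (ib_separate B) => j.
have [->|ji] := pselect (j = i); first exact: ib_coord_out.
exact: ib_coord_neq.
Qed.

(** The discretized module at t is the original module at floor t, so the same
    vectors and coordinates serve, for the preimages of the J i by the floor. *)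
Definition ib_discretize (V : pmodule k R) (I : Type) (J : I -> set R)
    (B : interval_basis V J) :
  interval_basis (discretize V) (fun i => @floorR R @^-1` J i).
Proof.
refine (@IntervalBasis k R (discretize V) I _
  (fun i t => ib_vec B i (floorR t)) (fun i t => ib_coord B i (floorR t))
  _ _ _ _ _ _).
- by move=> t; exact: (@ib_finite _ _ _ _ _ B (floorR t)).
- by move=> t; exact: (@ib_separate _ _ _ _ _ B (floorR t)).
- by move=> i t; exact: (@ib_coord_vec _ _ _ _ _ B i (floorR t)).
- by move=> i j t; exact: (@ib_coord_neq _ _ _ _ _ B i j (floorR t)).
- by move=> i t; exact: (@ib_coord_out _ _ _ _ _ B i (floorR t)).
- by move=> i s t st; exact: (ib_map_vec B (floorR_monotone st)).
Defined.

(** Expansion over any finite set S that contains the support of x. *)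
Lemma ib_expand (W : pmodule k R) (I : choiceType) (J : I -> set R)
    (B : interval_basis W J) t (x : W t) (S : set I) :
  finite_set S -> [set i | ib_coord B i t x <> 0] `<=` S ->
  x = \sum_(i <- fset_set S) ib_coord B i t x *: ib_vec B i t.
Proof.
move=> Sfin xS; apply/eqP; rewrite -subr_eq0; apply/eqP.
apply: (ib_separate B) => i; rewrite linearB linear_sum /=.
under eq_bigr do rewrite linearZ /=.
have [Jit|Jit] := pselect (J i t); last first.
  rewrite ib_coord_out // sub0r big1 ?oppr0 // => j _.
  by rewrite (ib_coord_out B _ Jit) mulr0.
have zero j : j != i -> ib_coord B j t x * ib_coord B i t (ib_vec B j t) = 0.
  by move=> /eqP ji; rewrite ib_coord_neq ?mulr0 // => /esym.
have [Si|Si] := boolP (i \in fset_set S).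
  rewrite (big_fsetD1 i) //= big_seq big1 ?addr0 => [|j]; last first.
    by rewrite in_fsetD1 => /andP[/zero].
  by rewrite ib_coord_vec // mulr1 subrr.
rewrite big_seq big1 => [|j jS]; last first.
  by apply: zero; apply: contraNneq Si => <-.
rewrite subr0; apply: contrapT => xi; move: Si.
by rewrite in_fset_set // => /negP; apply; rewrite inE; exact: xS.
Qed.

(** The fibre at t is spanned by finitely many vectors, and any index i with t
    in J i belongs to the finite support of one of them. *)
Lemma ib_finite_at (W : pmodule k R) (I : Type) (J : I -> set R)
    (B : interval_basis W J) t : pfd W -> finite_set [set i | J i t].
Proof.
move=> /(_ t)[n [[v2r v2r_lin [r2v v2rK r2vK]]]].
(* w is the basis of the fibre given by the coordinates v2r. *)
pose w (l : 'I_n) := r2v (delta_mx 0 l).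
apply: (@sub_finite_set _ _ (\bigcup_(l in [set: 'I_n])
    [set i | ib_coord B i t (w l) <> 0])); last first.
  by apply: bigcup_finite => // l _; exact: ib_finite.
move=> i /= Jit; apply: contrapT => noti.
have ciw l : ib_coord B i t (w l) = 0.
  by apply: contrapT => ciw; apply: noti; exists l.
pose f := GRing.isLinear.Build k (W t) 'rV[k]_n _ v2r v2r_lin.
pose v2r' : {linear W t -> 'rV[k]_n} := HB.pack v2r f.
have e_sum : ib_vec B i t = \sum_l v2r (ib_vec B i t) 0 l *: w l.
  apply: (can_inj v2rK); rewrite -[v2r]/(v2r' : _ -> _) linear_sum /=.
  rewrite [LHS]row_sum_delta; apply: eq_bigr => l _.
  by rewrite -[v2r]/(v2r' : _ -> _) linearZ /= r2vK.
have := ib_coord_vec B Jit; rewrite e_sum linear_sum big1 => [/eqP|l _].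
  by rewrite eq_sym oner_eq0.
by rewrite linearZ /= ciw mulr0.
Qed.


(** * Uniqueness of multiplicities *)

(** Only J j t is needed: when s is not in J j, both sides are zero. *)
Lemma ib_coord_map (W : pmodule k R) (I : choiceType) (J : I -> set R)
    (B : interval_basis W J) j s t (st : s <= t) (x : W s) :
  J j t -> ib_coord B j t (pm_map W st x) = ib_coord B j s x.
Proof.
move=> Jjt; pose S := [set i | ib_coord B i s x <> 0].
have Sfin : finite_set S by exact: ib_finite.
have xS := @ib_expand _ _ _ B s x S Sfin (fun=> id).
rewrite {1}xS !linear_sum /=.
have term i : ib_coord B j t (pm_map W st (ib_coord B i s x *: ib_vec B i s)) =
    ib_coord B j s (ib_coord B i s x *: ib_vec B i s).
  rewrite !linearZ /=; have [Jis|Jis] := pselect (J i s); last first.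
    by rewrite (ib_coord_out B _ Jis) !mul0r.
  rewrite ib_map_vec //; have [ij|ji] := pselect (i = j).
    by rewrite -ij in Jjt *; rewrite !ib_coord_vec.
  by rewrite !ib_coord_neq // => /esym.
by under eq_bigr do rewrite term; rewrite -linear_sum -xS.
Qed.

(** The coefficient at t of a morphism I_{J i} -> I_{J' j} vanishes if some
    s <= t lies in J i and not in J' j: it may be computed at s. *)
Lemma ib_coord_vec_up0 (W : pmodule k R) (I I' : choiceType) (J : I -> set R)
    (J' : I' -> set R) (B : interval_basis W J) (B' : interval_basis W J')
    i j s t : s <= t -> J i s -> ~ J' j s ->
  ib_coord B' j t (ib_vec B i t) = 0.
Proof.
move=> st Jis J'js; have [J'jt|] := pselect (J' j t); last exact: ib_coord_out.
by rewrite -(ib_map_vec B st Jis) ib_coord_map // ib_coord_out.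
Qed.

(** The coefficient at t of a morphism I_{J' j} -> I_{J i} vanishes if some
    s >= t lies in J i and not in J' j: it may be computed at s. *)
Lemma ib_coord_vec_down0 (W : pmodule k R) (I I' : choiceType) (J : I -> set R)
    (J' : I' -> set R) (B : interval_basis W J) (B' : interval_basis W J')
    i j s t : t <= s -> J i s -> ~ J' j s ->
  ib_coord B i t (ib_vec B' j t) = 0.
Proof.
move=> ts Jis J'js; have [J'jt|] := pselect (J' j t); last first.
  by move=> /(ib_vec_out B') ->; exact: linear0.
by rewrite -(ib_coord_map B ts _ Jis) ib_map_vec // ib_vec_out // linear0.
Qed.

(** Morphisms I_K -> I_K' -> I_K compose to zero when K' <> K: a point of
    exactly one of K and K' kills one of the two factors, depending on the side
    of t on which it lies. *)
Lemma ib_round_trip0 (W : pmodule k R) (I I' : choiceType) (J : I -> set R)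
    (J' : I' -> set R) (B : interval_basis W J) (B' : interval_basis W J')
    i i0 j t : J i0 = J i -> J' j <> J i ->
  ib_coord B' j t (ib_vec B i t) * ib_coord B i0 t (ib_vec B' j t) = 0.
Proof.
move=> Ji0 J'j; have [s [[Js J's]|[Js J's]]] :
    exists s, (J i s /\ ~ J' j s) \/ (J' j s /\ ~ J i s).
  apply: contrapT => /forallNP nos; apply: J'j; apply/seteqP; split=> s Hs;
    apply: contrapT => nHs; apply: (nos s); [right|left]; by split.
- have [st|/ltW ts] := leP s t.
    by rewrite (ib_coord_vec_up0 B B' st Js J's) mul0r.
  by rewrite (@ib_coord_vec_down0 _ _ _ _ _ B B' i0 j s) ?mulr0 // Ji0.
- have [st|/ltW ts] := leP s t.
    by rewrite (@ib_coord_vec_up0 _ _ _ _ _ B' B j i0 s) ?mulr0 // Ji0.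
  by rewrite (@ib_coord_vec_down0 _ _ _ _ _ B' B j i s) ?mul0r.
Qed.

Lemma ib_multiplicity_le (W : pmodule k R) (I I' : choiceType) (J : I -> set R)
    (J' : I' -> set R) (B : interval_basis W J) (B' : interval_basis W J')
    (K : set R) : K !=set0 ->
  finite_set [set i | J i = K] -> finite_set [set j | J' j = K] ->
  (#|` fset_set [set i | J i = K]| <= #|` fset_set [set j | J' j = K]|)%N.
Proof.
case=> t Kt finJ finJ'.
set A := fset_set _; set A' := fset_set [set j | _].
have inA i : i \in A -> J i = K by rewrite in_fset_set // inE.
pose F := \matrix_(p < #|{: A}|, q < #|{: A'}|)
  ib_coord B' (val (enum_val q)) t (ib_vec B (val (enum_val p)) t).
pose G := \matrix_(q < #|{: A'}|, p < #|{: A}|)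
  ib_coord B (val (enum_val p)) t (ib_vec B' (val (enum_val q)) t).
rewrite !cardfE; apply: (@mulmx1_min k _ _ F G); apply/matrixP => p p'.
rewrite !mxE; set i := val (enum_val p); set i' := val (enum_val p').
have Ji : J i = K by apply: inA; exact: valP.
have Ji' : J i' = K by apply: inA; exact: valP.
pose f j := ib_coord B' j t (ib_vec B i t) * ib_coord B i' t (ib_vec B' j t).
(* The sum over A' is completed to the expansion of the i-th vector of B in
   the basis B': the additional terms vanish by ib_round_trip0. *)
transitivity (\sum_(j <- A') f j).
  rewrite big_seq_fsetE (reindex (@enum_val _ {: A'})) /=; last first.
    by apply: onW_bij; exact: enum_val_bij.
  by apply: eq_bigr => q _; rewrite !mxE.
pose S := [set j | ib_coord B' j t (ib_vec B i t) <> 0] `|` [set j | J' j = K].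
have finS : finite_set S by rewrite finite_setU; split=> //; exact: ib_finite.
rewrite (big_fset_incl _ (B := fset_set S)); first last.
- move=> j _; rewrite in_fset_set // => /negP J'j.
  by apply: ib_round_trip0; rewrite ?Ji // => J'jK; apply: J'j; rewrite inE.
- apply/fsubsetP => j; rewrite !in_fset_set // => /set_mem J'j.
  by apply/mem_set; right.
transitivity (ib_coord B i' t (ib_vec B i t)).
  rewrite [in RHS](@ib_expand _ _ _ B' t (ib_vec B i t) S) //; last by left.
  by rewrite linear_sum; apply: eq_bigr => j _; rewrite linearZ.
have [pp'|/eqP pp'] := eqVneq p p'.
  by rewrite /i pp' ib_coord_vec // -/i' Ji'.
by rewrite ib_coord_neq // => /val_inj/enum_val_inj/esym.
Qed.

Lemma ib_multiplicity_eq (W : pmodule k R) (I I' : choiceType)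
    (J : I -> set R) (J' : I' -> set R) (K : set R) :
  pfd W -> interval_basis W J -> interval_basis W J' -> K !=set0 ->
  ([set i | J i = K] #= [set j | J' j = K])%card.
Proof.
move=> Wfd B B' [t Kt].
have fin : finite_set [set i | J i = K].
  by apply: sub_finite_set (ib_finite_at B t Wfd) => i /= ->.
have fin' : finite_set [set i | J' i = K].
  by apply: sub_finite_set (ib_finite_at B' t Wfd) => i /= ->.
have [[n An] [m Am]] := ((finite_setP _).1 fin, (finite_setP _).1 fin').
have : n = m.
  apply/eqP; rewrite eqn_leq -(card_fset_set An) -(card_fset_set Am).
  have K0 : K !=set0 by exists t.
  by rewrite (ib_multiplicity_le B B') // (ib_multiplicity_le B' B).
by move=> nm; rewrite nm in An; rewrite (card_eq_trans An) // card_eq_sym.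
Qed.

End IntervalBasis.

(** * The interval basis attached to a persistence diagram *)

Section DiagramBasis.
Variables (k : fieldType) (R : realType).

(** The coordinate of x in the space of I_J at t.  The sum has a single term if
    t is in J and none otherwise, which avoids a cast along the value of
    t \in J. *)
Definition interval_coord (J : rinterval R) t (x : interval_space k J t) : k :=
  \sum_l (x : 'rV[k]_(t \in (J : set R))) 0 l.

Fact interval_coord_scalar J t : scalar (@interval_coord J t).
Proof.
move=> a x y; rewrite /interval_coord mulr_sumr -big_split /=.
by apply: eq_bigr => l _; rewrite !mxE.
Qed.

HB.instance Definition _ J t := GRing.isLinear.Build k (interval_space k J t) k
  _ (@interval_coord J t) (@interval_coord_scalar J t).

(** The generator of I_J at t: 1 if t is in J, and the only vector of the zero
    space otherwise. *)
Definition interval_gen (J : rinterval R) t : interval_space k J t :=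
  const_mx 1 : 'rV[k]_(t \in (J : set R)).

Lemma interval_coord_gen (J : rinterval R) t :
  (J : set R) t -> interval_coord (interval_gen J t) = 1.
Proof.
move=> /mem_set Jt; rewrite /interval_coord.
under eq_bigr do rewrite mxE.
by rewrite sumr_const card_ord Jt.
Qed.

Lemma interval_coord_out (J : rinterval R) t (x : interval_space k J t) :
  ~ (J : set R) t -> interval_coord x = 0.
Proof.
move=> Jt; apply: big1 => l; exfalso; apply: Jt; apply: set_mem.
by case: (t \in (J : set R)) l => // -[].
Qed.

Lemma interval_coord_eq0 (J : rinterval R) t (x : interval_space k J t) :
  interval_coord x = 0 -> x = 0.
Proof.
rewrite /interval_coord => x0; apply/rowP => l; move: x x0 l.
rewrite /interval_space; case: (t \in (J : set R)) => x; last by move=> _ [].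
by rewrite big_ord1 => x0 l; rewrite ord1 x0 mxE.
Qed.

Lemma interval_map_gen (J : rinterval R) s t (st : s <= t) :
  (J : set R) s -> interval_map k J st (interval_gen J s) = interval_gen J t.
Proof.
move=> /mem_set Js; rewrite /interval_map /interval_gen /interval_space /=.
rewrite Js; case: (t \in (J : set R)).
  by rewrite pid_mx_1 mulmx1.
by rewrite [LHS]thinmx0 [RHS]thinmx0.
Qed.

Variables (I : Type) (J : I -> rinterval R).
Let M : pmodule k R := pm_dsum (fun i => interval_module k (J i)).

(** The generator at t of the i-th summand, seen in the direct sum. *)
Program Definition dsum_gen i t : M t :=
  @DSum k I (fun j => interval_module k (J j) t)
    (fun j => if pselect (j = i) then interval_gen (J j) t else 0) _.
Next Obligation.
move=> i t; apply: (sub_finite_set _ (finite_set1 i)) => j /=.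
by case: pselect.
Qed.

Lemma dsum_genE i t : dsum_val (dsum_gen i t) i = interval_gen (J i) t.
Proof. by rewrite /=; case: pselect. Qed.

Lemma dsum_gen_neq i j t : i <> j -> dsum_val (dsum_gen j t) i = 0.
Proof. by rewrite /=; case: pselect. Qed.

Lemma dsum_map_gen i s t (st : s <= t) : (J i : set R) s ->
  pm_map M st (dsum_gen i s) = dsum_gen i t.
Proof.
move=> Js; apply: dsumP => j; rewrite /=.
case: pselect => [ji|_] /=; last exact: mul0mx.
by subst j; exact: interval_map_gen.
Qed.

Variables (V : pmodule k R) (f : pm_hom V M) (g : pm_hom M V).
Hypothesis fK : forall t, cancel (f t) (g t).
Hypothesis gK : forall t, cancel (g t) (f t).

(** The i-th coordinate of a vector of V, read through the isomorphism f. *)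
Definition pm_coord i t (x : V t) : k := interval_coord (dsum_val (f t x) i).

Fact pm_coord_scalar i t : scalar (@pm_coord i t).
Proof. by move=> a x y; rewrite /pm_coord linearP /= linearP. Qed.

HB.instance Definition _ i t := GRing.isLinear.Build k (V t) k
  _ (@pm_coord i t) (@pm_coord_scalar i t).

(** The generators are carried over by g, and the coordinates by its inverse
    f. *)
Definition interval_basis_of_iso :
  interval_basis V (fun i => J i : set R).
Proof.
refine (@IntervalBasis k R V I _ (fun i t => g t (dsum_gen i t))
  (fun i t => @pm_coord i t) _ _ _ _ _ _).
- move=> t x; apply: (sub_finite_set _ (dsum_finite (f t x))) => i /= xi xi0.
  by apply: xi; rewrite /pm_coord xi0 linear0.
- move=> t x x0; rewrite -(fK x).
  suff -> : f t x = 0 by exact: linear0.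
  by apply: dsumP => i; apply: interval_coord_eq0; exact: x0.
- move=> i t Jt; rewrite /= /pm_coord gK dsum_genE.
  exact: interval_coord_gen.
- by move=> i j t ij; rewrite /= /pm_coord gK dsum_gen_neq // linear0.
- by move=> i t x Jt; exact: interval_coord_out.
- by move=> i s t st Js; rewrite -pm_hom_natural dsum_map_gen.
Defined.

End DiagramBasis.

(** The index type is made a choice type, so that sums over finite sets of
    indices are available. *)
Lemma is_PD_interval_basis (k : fieldType) (R : realType) (V : pmodule k R)
    (D : set (dpoint R)) : is_PD V D ->
  exists (I : choiceType) (J : I -> set R) (e : I -> dpoint R),
    [/\ inhabited (interval_basis V J),
        forall i, J i !=set0 /\ is_interval (J i),
        set_bij [set: I] D e &
        forall i, birth (e i) = ereal_inf (EFin @` J i) /\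
                  death (e i) = ereal_sup (EFin @` J i)].
Proof.
case=> _ [I [J [e [[f [g fg]] ebij eE]]]].
exists {classic I}, (fun i => J i : set R), e; split=> // [|i].
  constructor; apply: (@interval_basis_of_iso k R I J V f g) => t.
    exact: (fg t).1.
  exact: (fg t).2.
by split; [exact: rint_nonempty|exact: rint_interval].
Qed.

(** * Endpoints of an interval and of its preimage by the floor *)

Section FloorPreimage.
Variables (R : realType) (J : set R).
Hypothesis Jint : is_interval J.
Let JZ := @floorR R @^-1` J.

Section Nonempty.
Hypothesis JZ0 : JZ !=set0.

Lemma le_ereal_inf_floor_preimage :
  (ereal_inf (EFin @` J) <= ereal_inf (EFin @` JZ))%E.
Proof.
apply/ereal_infP => _ [t Jt <-]; apply: ge_ereal_inf.
by exists (floorR t)%:E; [exists (floorR t)|rewrite lee_fin; exact: floorR_le].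
Qed.

Lemma ereal_inf_floor_preimageB1_le :
  (ereal_inf (EFin @` JZ) - 1 <= ereal_inf (EFin @` J))%E.
Proof.
have [t0 Jn] := JZ0; rewrite /JZ /= /floorR in Jn.
apply/ereal_infP => _ [x Jx <-]; rewrite leeBlDr //.
suff [y JZy yx] : exists2 y, JZ y & y <= x + 1.
  by apply: ge_ereal_inf; exists y%:E; [exists y|rewrite -EFinD lee_fin].
(* y is the integer n = floor t0 of J if n <= x; otherwise it is the least
   integer above x, which lies between x and n and hence in J. *)
have [nx|xn] := leP (Num.floor t0)%:~R x.
  exists (Num.floor t0)%:~R; first by rewrite /JZ /= floorR_int.
  by rewrite (le_trans nx) // lerDl.
exists (Num.floor x + 1)%:~R; last by rewrite intrD1 lerD2r; exact: floorR_le.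
rewrite /JZ /= floorR_int; apply: (Jint Jx Jn).
rewrite {1}intrD1 ltW ?ltD1_floorR //=.
by rewrite ler_int -ltzD1 ltrD2r -(ltr_int R) (le_lt_trans (floorR_le x)).
Qed.

Lemma le_ereal_sup_floor_preimage :
  (ereal_sup (EFin @` J) <= ereal_sup (EFin @` JZ))%E.
Proof.
have [t0 Jn] := JZ0; rewrite /JZ /= /floorR in Jn.
apply: ge_ereal_sup => _ [x Jx <-].
suff [y JZy xy] : exists2 y, JZ y & x <= y.
  apply: (@le_trans _ _ y%:E); first by rewrite lee_fin.
  by apply: ereal_sup_ubound; exists y.
have [nx|xn] := leP (Num.floor t0)%:~R x; last first.
  by exists (Num.floor t0)%:~R; [rewrite /JZ /= floorR_int|exact: ltW].
exists x => //; apply: (Jint Jn Jx).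
by rewrite le_floorR // floorR_le.
Qed.

Lemma ereal_sup_floor_preimageB1_le :
  (ereal_sup (EFin @` JZ) - 1 <= ereal_sup (EFin @` J))%E.
Proof.
rewrite leeBlDr //; apply: ge_ereal_sup => _ [t Jt <-].
rewrite -leeBlDr //; apply: (@le_trans _ _ (floorR t)%:E).
  by rewrite -EFinB lee_fin lerBlDr ltW // ltD1_floorR.
by apply: ereal_sup_ubound; exists (floorR t).
Qed.

End Nonempty.

(** An interval without integers lies in ]n, n + 1[, with n the floor of any of
    its points. *)
Lemma ereal_sup_floor_preimage0 : J !=set0 -> JZ = set0 ->
  (ereal_sup (EFin @` J) <= efloor (ereal_inf (EFin @` J) + 1))%E.
Proof.
case=> x Jx JZ0; pose n := Num.floor x.
have noZ m : ~ J m%:~R.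
  by move=> Jm; have : set0 (m%:~R : R) by rewrite -JZ0 /JZ /= floorR_int.
have J_gt y : J y -> n%:~R < y.
  move=> Jy; rewrite ltNge; apply/negP => yn; apply: (noZ n).
  by apply: (Jint Jy Jx); rewrite yn floorR_le.
have J_lt y : J y -> y < (n + 1)%:~R.
  move=> Jy; rewrite ltNge; apply/negP => ny; apply: (noZ (n + 1)).
  by apply: (Jint Jx Jy); rewrite ny andbT intrD1 ltW // ltD1_floorR.
have : (n%:~R%:E <= ereal_inf (EFin @` J))%E.
  by apply/ereal_infP => _ [y Jy <-]; rewrite lee_fin ltW // J_gt.
have : (ereal_inf (EFin @` J) <= x%:E)%E by apply: ereal_inf_lbound; exists x.
case: (ereal_inf _) => [b| |] //= _; rewrite !lee_fin => nb.
apply: ge_ereal_sup => _ [y Jy <-]; rewrite lee_fin.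
apply: (le_trans (ltW (J_lt y Jy))); apply: le_floorR.
by rewrite intrD1 lerD2r.
Qed.

End FloorPreimage.

(** * Matchings *)

Lemma is_matching_of_injective_relation (A B : Type) (S : set A) (T : set B)
    (X : set (A * B)) :
  (forall s t, X (s, t) -> S s /\ T t) ->
  (forall s t t', X (s, t) -> X (s, t') -> t = t') ->
  (forall s s' t, X (s, t) -> X (s', t) -> s = s') ->
  is_matching S T X.
Proof.
move=> XST Xfun Xinj.
pose S' := [set s | exists t, X (s, t)].
pose T' := [set t | exists s, X (s, t)].
have imS (s : S') : {t : T' | X (set_val s, set_val t)}.
  apply: cid; case: s => s sS /=; have [t Xst] := set_mem sS.
  have tT : t \in T' by apply/mem_set; exists s.
  by exists (exist _ t tT).
exists S', T', (fun s => sval (imS s)); split.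
- by move=> s [t /XST[]].
- by move=> t [s /XST[]].
- move=> s s' ss'; apply: val_inj => /=.
  apply: (Xinj _ _ (set_val (sval (imS s)))); first exact: svalP (imS s).
  by rewrite ss'; exact: svalP (imS s').
- apply/seteqP; split=> [[s t] Xst|_ [s ->]]; last exact: svalP (imS s).
  have sS : s \in S' by apply/mem_set; exists t.
  exists (exist _ s sS); congr pair.
  by apply: (Xfun s) => //; exact: svalP (imS (exist _ s sS)).
Qed.

(** A bijection as a relation on the ambient types, which requires no default
    value and no subtype. *)
Lemma card_eq_relation (A B : Type) (S : set A) (T : set B) :
  (S #= T)%card -> exists r : A -> B -> Prop,
  [/\ forall x y, r x y -> S x /\ T y,
      forall x, S x -> exists y, r x y,
      forall y, T y -> exists x, r x y,
      forall x y y', r x y -> r x y' -> y = y' &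
      forall x x' y, r x y -> r x' y -> x = x'].
Proof.
move=> /card_bijP[f [g fK gK]].
exists (fun x y => exists s : S, x = set_val s /\ y = set_val (f s)); split.
- by move=> _ _ [s [-> ->]]; split; apply: set_valP.
- by move=> x /mem_set xS; exists (set_val (f (exist _ x xS))), (exist _ x xS).
- move=> y /mem_set yT; exists (set_val (g (exist _ y yT))), (g (exist _ y yT)).
  by rewrite gK.
- by move=> _ _ _ [s [-> ->]] [s' [/val_inj <- ->]].
- by move=> _ _ _ [s [-> ->]] [s' [-> /val_inj/(can_inj fK)->]].
Qed.

Theorem proposition5p2 (k : fieldType) (R : realType) (V : pmodule k R)
    (V_pfd : pfd V) :
  interleaved (fun t : R => t) (@ceilR R) (discretize V) V /\
  (forall (DZ D : set (dpoint R)),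
     is_PD (discretize V) DZ -> is_PD V D ->
     exists X : set (dpoint R * dpoint R),
       [/\ is_matching DZ D X,
           (forall p q, X (p, q) ->
              (birth p - 1 <= birth q <= birth p)%E /\
              (death p - 1 <= death q <= death p)%E),
           (forall p, unmatched_left DZ X p -> death p = (birth p + 1)%E) &
           (forall q, unmatched_right D X q ->
              (death q <= efloor (birth q + 1))%E)]).
Proof.
split=> [|DZ D]; first exact: discretize_interleaved.
move=> /is_PD_interval_basis[IZ [JZ [eZ [[BZ] JZint [eZD eZinj eZsurj] eZE]]]].
move=> /is_PD_interval_basis[I [J [e [[B] Jint [eD einj esurj] eE]]]].
pose J' i := @floorR R @^-1` J i.
(* For each nonempty K, r K is a bijection between the summands of the
   discretized module equal to K and those of V whose discretization is K. *)
have eqmult (K : set R) : exists r : IZ -> I -> Prop, K !=set0 ->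
    [/\ forall i j, r i j -> JZ i = K /\ J' j = K,
      forall i, JZ i = K -> exists j, r i j,
      forall j, J' j = K -> exists i, r i j,
      forall i j j', r i j -> r i j' -> j = j' &
      forall i i' j, r i j -> r i' j -> i = i'].
  have [K0|K0] := pselect (K !=set0); last by exists (fun _ _ => False).
  have := ib_multiplicity_eq (discretize_pfd V_pfd) BZ (ib_discretize B) K0.
  by move=> /card_eq_relation[r rP]; exists r.
have [r rP] := choice eqmult.
pose X := [set pq | exists i j, [/\ r (JZ i) i j, pq.1 = eZ i & pq.2 = e j]].
have XE i j : r (JZ i) i j -> J' j = JZ i.
  by have [rK _ _ _ _] := rP _ (JZint i).1 => /rK[].
exists X; split.
- apply: is_matching_of_injective_relation.
  + by move=> _ _ [i [j [_ /= -> ->]]]; split; [exact: eZD|exact: eD].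
  + move=> _ _ _ [i [j [rij /= -> ->]]] [i' [j' [rij' /= ii' ->]]].
    have {}ii' : i = i' by apply: eZinj ii'; rewrite inE.
    subst i'; congr e.
    by have [_ _ _ rfun _] := rP _ (JZint i).1; exact: (rfun i).
  + move=> _ _ _ [i [j [rij /= -> ->]]] [i' [j' [rij' /= -> jj']]].
    have {}jj' : j = j' by apply: einj jj'; rewrite inE.
    subst j'; congr eZ; have JJ : JZ i' = JZ i.
      by rewrite -(XE _ _ rij) (XE _ _ rij').
    have [_ _ _ _ rinj] := rP _ (JZint i).1; apply: (rinj _ _ j) => //.
    by rewrite -JJ.
- move=> _ _ [i [j [/XE JJ /= -> ->]]].
  have [-> ->] := eZE i; have [-> ->] := eE j; rewrite -JJ.
  have J'0 : J' j !=set0 by rewrite JJ; exact: (JZint i).1.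
  have Jj := (Jint j).2.
  split; apply/andP; split.
  + exact: ereal_inf_floor_preimageB1_le.
  + exact: le_ereal_inf_floor_preimage.
  + exact: ereal_sup_floor_preimageB1_le.
  + exact: le_ereal_sup_floor_preimage.
(* No point on the left is unmatched. *)
- move=> p [/eZsurj[i _ <-] noX]; exfalso.
  have [_ rleft _ _ _] := rP _ (JZint i).1; have [j rij] := rleft i erefl.
  by apply: (noX (e j)); exists i, j.
- move=> q [/esurj[j _ <-] noX]; have [-> ->] := eE j.
  apply: ereal_sup_floor_preimage0; [exact: (Jint j).2|exact: (Jint j).1|].
  apply: contrapT => /eqP/set0P J'0.
  have [rK _ rright _ _] := rP _ J'0; have [i rij] := rright j erefl.
  apply: (noX (eZ i)); exists i, j; split=> //.
  by have [-> _] := rK _ _ rij.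
Qed.
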